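(* The class of multi-path matroids is closed under deletion: if $M$ is a multi-path matroid and $x$ is an element of $M$, then $M\backslash x$ is a multi-path matroid.
   Context: Transversal matroid $M[\mathcal{A}]$ of a multiset $\mathcal{A}=(A_j:j\in J)$ of subsets of a finite set $S$: independent sets are the sets $\{x_k:k\in K\}$ of $|K|$ distinct elements with $K\subseteq J$, $x_k\in A_k$; $\mathcal{A}$ is a presentation. For a cyclic permutation $\sigma$ of $S$, a $\sigma$-interval is a nonempty set $\{f,\sigma(f),\ldots,l\}$. A multi-path matroid is a transversal matroid with a presentation by an antichain (no member containing another) of $\sigma$-intervals for some cyclic permutation $\sigma$ of its ground set. *)

(* Defs.v *)
From HB Require Import structures.
From mathcomp Require Import all_boot all_fingroup.

Set Implicit Arguments.
Unset Strict Implicit.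
Unset Printing Implicit Defensive.

(* A matroid on a ground set contained in T, by its independent sets. *)
Record matroid (T : finType) := Matroid {
  ground : {set T};
  indep : {set {set T}};
  indep_ground : forall X, X \in indep -> X \subset ground;
  indep_set0 : set0 \in indep;
  indep_subset : forall X Y : {set T},
    X \subset Y -> Y \in indep -> X \in indep;
  indep_augment : forall X Y : {set T},
    X \in indep -> Y \in indep -> #|X| < #|Y| ->
    exists2 y, y \in Y :\: X & y |: X \in indep
}.

Section Deletion.

Variables (T : finType) (M : matroid T) (x : T).

Definition del_ground : {set T} := ground M :\ x.
Definition del_indep : {set {set T}} :=
  [set X in indep M | X \subset del_ground].

Lemma del_indep_ground X : X \in del_indep -> X \subset del_ground.
Proof. by rewrite inE => /andP[]. Qed.

Lemma del_indep_set0 : set0 \in del_indep.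
Proof. by rewrite inE indep_set0 sub0set. Qed.

Lemma del_indep_subset (X Y : {set T}) :
  X \subset Y -> Y \in del_indep -> X \in del_indep.
Proof.
move=> sXY; rewrite !inE => /andP[iY sY].
by rewrite (indep_subset sXY iY) (subset_trans sXY sY).
Qed.

Lemma del_indep_augment (X Y : {set T}) :
  X \in del_indep -> Y \in del_indep -> #|X| < #|Y| ->
  exists2 y, y \in Y :\: X & y |: X \in del_indep.
Proof.
rewrite !inE => /andP[iX sX] /andP[iY sY] ltXY.
have [y yYX iyX] := indep_augment iX iY ltXY; exists y => //.
rewrite inE iyX subUset sX sub1set andbT.
by apply: (subsetP sY); case/setDP: yYX.
Qed.

Definition deletion : matroid T :=
  Matroid del_indep_ground del_indep_set0 del_indep_subset del_indep_augment.

End Deletion.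

(* X = {x_k : k in K} with the x_k distinct and x_k in A_k.  The choice
   function x lives on the subtype K so that K = set0 is allowed even when T
   is empty. *)
Definition partial_transversal (T J : finType) (A : J -> {set T})
    (X : {set T}) : Prop :=
  exists (K : {set J}) (x : {k : J | k \in K} -> T),
    [/\ injective x,
        forall k, x k \in A (val k)
      & X = [set x k | k : {k : J | k \in K}]].

(* M = M[A]; the indexed family A plays the role of a multiset of subsets. *)
Definition presentation (T J : finType) (M : matroid T) (A : J -> {set T})
    : Prop :=
  (forall j, A j \subset ground M) /\
  (forall X : {set T}, X \in indep M <-> partial_transversal A X).

(* The empty permutation of the empty set counts as cyclic, so that the
   deletion of the only element of a matroid is covered. *)
Definition cyclic_perm_on (T : finType) (E : {set T}) (sigma : {perm T})
    : Prop :=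
  perm_on E sigma /\ {in E &, forall x y, y \in porbit sigma x}.

(* {f, sigma f, ..., l} with l = sigma^n f. *)
Definition sigma_interval (T : finType) (E : {set T}) (sigma : {perm T})
    (I : {set T}) : Prop :=
  exists (f : T) (n : nat),
    [/\ f \in E, n < #|E| & I = [set y in traject sigma f n.+1]].

(* In terms of indices, so an antichain has no repeated member. *)
Definition antichain (T J : finType) (A : J -> {set T}) : Prop :=
  forall i j : J, i != j -> ~~ (A i \subset A j).

Definition multi_path_matroid (T : finType) (M : matroid T) : Prop :=
  exists (sigma : {perm T}) (J : finType) (A : J -> {set T}),
    [/\ cyclic_perm_on (ground M) sigma,
        forall j, sigma_interval (ground M) sigma (A j),
        antichain A
      & presentation M A].

(* Main.v *)
Require Import Defs.
From mathcomp Require Import all_boot all_fingroup.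

Set Implicit Arguments.
Unset Strict Implicit.
Unset Printing Implicit Defensive.

(** Deleting [x] from every interval of an antichain presentation of [M], and
    bypassing [x] in the cyclic permutation, gives a presentation of [M \ x] by
    intervals, some of which may be empty or contain others.  If [A_i] is
    contained in [A_j] and [e] is in [A_i], replacing [A_j] by [A_j - e] does
    not change the matroid: when [e] is matched to [j], exchange the roles of
    [i] and [j].  To keep intervals, [e] has to be an end of [A_j], so one
    maintains the invariant that whenever [A_i] is contained in [A_j], it
    contains an end of [A_j].  Consider an inclusion of [I - e] in [I'] created
    by removing [e] from an interval [I].  If [e] is not in [I'], then a
    neighbour of [e] in [I] is an end of [I'].  This is always the case for the
    deletion of [x], as the original intervals form an antichain.  If [e] is in
    [I'], then [I'] contains [I]; always trimming a containing interval of
    maximal size gives [I' = I], and [I - e] contains the other end.  Once no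
    inclusion between nonempty members is left, these form an antichain. *)

Section PartialTransversals.

Variables (T J : finType).
Implicit Types (A B : J -> {set T}) (X : {set T}).

Lemma partial_transversalP A X :
  partial_transversal A X <->
  exists2 g : {y | y \in X} -> J, injective g & forall y, val y \in A (g y).
Proof.
split=> [[K [c [c_inj cA ->]]]|[g g_inj gA]].
  have [y|h hK] := @fin_all_exists {y | y \in [set c k | k : {k | k \in K}]} _
    (fun y k => val y = c k).
    by case: y => y /= /imsetP[k _ ->]; exists k.
  exists (fun y => val (h y)) => [y z /val_inj eq_h|y]; last by rewrite hK.
  by apply: val_inj; rewrite !hK eq_h.
pose K := [set g y | y : {y | y \in X}].
have [k|h hK] := @fin_all_exists {k | k \in K} _ (fun k y => val k = g y).
  by case: k => k /= /imsetP[y _ ->]; exists y.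
exists K, (fun k => val (h k)); split.
- by move=> k l /val_inj eq_h; apply: val_inj; rewrite !hK eq_h.
- by move=> k; rewrite hK.
apply/setP=> y; apply/idP/imsetP=> [yX|[k _ ->]]; last exact: valP.
have gyK : g (exist _ y yX) \in K by apply: imset_f.
pose gy := exist (fun k => k \in K) _ gyK.
by exists gy; rewrite // -(g_inj _ _ (hK gy)).
Qed.

Lemma partial_transversalS A B X :
    (forall j, A j \subset B j) ->
  partial_transversal A X -> partial_transversal B X.
Proof.
move=> sAB /partial_transversalP[g g_inj gA]; apply/partial_transversalP.
by exists g => // y; apply: (subsetP (sAB _)).
Qed.

Lemma partial_transversalD1 A x X :
  partial_transversal (fun j => A j :\ x) X <->
  partial_transversal A X /\ x \notin X.
Proof.
split=> [tX|[/partial_transversalP[g g_inj gA] xX]].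
  split; first by apply: partial_transversalS tX => j; apply: subD1set.
  have /partial_transversalP[g _ gA] := tX.
  by apply/negP=> xX; have := gA (Sub x xX); rewrite !inE eqxx.
apply/partial_transversalP; exists g => // y; rewrite !inE gA andbT.
by apply: contraNneq xX => <-; apply: valP.
Qed.

Lemma partial_transversal_trim A i j e X :
    i != j -> A i \subset A j -> e \in A i ->
  partial_transversal [eta A with j |-> A j :\ e] X <-> partial_transversal A X.
Proof.
move=> neq_ij sij ei; split.
  apply: partial_transversalS => k /=.
  by case: eqP => [->|_]; rewrite ?subD1set.
move=> /partial_transversalP[g g_inj gA]; apply/partial_transversalP.
have [/existsP[y0 /andP[/eqP y0e /eqP gy0]]|not_ge] :=
    boolP [exists y, (val y == e) && (g y == j)].
  exists (fun y => tperm i j (g y)) => [y z /perm_inj/g_inj //|y /=].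
  case: tpermP => [gyi|gyj|_ /eqP/negPf->]; last exact: gA.
    rewrite eqxx !inE (subsetP sij) ?andbT; last by rewrite -gyi gA.
    apply: contra_neq neq_ij => ye; rewrite -gyi -gy0; congr g.
    by apply: val_inj; rewrite y0e.
  by rewrite (negPf neq_ij) (g_inj y y0) ?gyj // y0e.
exists g => // y /=; case: eqP => [gyj|_]; last exact: gA.
rewrite !inE -gyj gA andbT.
by apply: contra not_ge => ye; apply/existsP; exists y; rewrite ye gyj /=.
Qed.

End PartialTransversals.

Lemma partial_transversal_nonempty (T J : finType) (A : J -> {set T}) X :
  partial_transversal (fun k : {j | A j != set0} => A (val k)) X <->
  partial_transversal A X.
Proof.
split=> /partial_transversalP[g g_inj gA]; apply/partial_transversalP.
  by exists (fun y => val (g y)) => // y z /val_inj/g_inj.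
have A0 y : A (g y) != set0 by apply/set0Pn; exists (val y).
by exists (fun y => Sub (g y) (A0 y)) => // y z [/g_inj].
Qed.

Section Presentations.

Variables (T J : finType) (M : matroid T).
Implicit Types A B : J -> {set T}.

Lemma eq_presentation A B : A =1 B -> presentation M A -> presentation M B.
Proof.
move=> eqAB [sA indA]; split=> [j|X]; first by rewrite -eqAB.
apply: (iff_trans (indA X)).
by split; apply: partial_transversalS => j; rewrite eqAB.
Qed.

Lemma presentation_deletion A x :
  presentation M A -> presentation (deletion M x) (fun j => A j :\ x).
Proof.
move=> [sA indA]; split=> [j|X]; first exact: setSD.
apply: iff_trans (iff_sym (partial_transversalD1 A x X)).
rewrite inE; split=> [/andP[/[dup] /indA tX _]|[/indA iX xX]].
  by rewrite subsetD1 => /andP[].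
by rewrite iX subsetD1 (indep_ground iX).
Qed.

Lemma presentation_trim A i j e :
    i != j -> A i \subset A j -> e \in A i ->
  presentation M A -> presentation M [eta A with j |-> A j :\ e].
Proof.
move=> neq_ij sij ei [sA indA]; split=> [k /=|X].
  by case: eqP => // _; apply: subset_trans (sA j); apply: subD1set.
exact: iff_trans (indA X) (iff_sym (partial_transversal_trim X neq_ij sij ei)).
Qed.

Lemma presentation_nonempty A :
    presentation M A ->
  presentation M (fun k : {j | A j != set0} => A (val k)).
Proof.
move=> [sA indA]; split=> [k //|X].
exact: iff_trans (indA X) (iff_sym (partial_transversal_nonempty A X)).
Qed.

End Presentations.

Section Ends.

Variable T : eqType.
Implicit Types (s : seq T) (e z : T).

(* Membership in [s] makes the defaults of [head] and [last] irrelevant. *)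
Definition ends s : pred T :=
  [pred z in s | (head z s == z) || (last z s == z)].

Lemma last_rem s e a : last a s != e -> last a (rem e s) = last a s.
Proof.
elim: s a => //= b s IHs a ls_e.
have [be|be] := eqVneq b e; last exact: IHs.
by case: s ls_e {IHs} => //=; rewrite be eqxx.
Qed.

Lemma ends_rem s e z : z \in ends s -> z != e -> z \in ends (rem e s).
Proof.
move=> /andP[zs end_z] ze; rewrite inE /= rem_mem //=.
case/orP: end_z => /eqP; last by move=> lz; rewrite last_rem lz ?eqxx ?orbT.
by case: s zs => //= a s _ ->; rewrite (negPf ze) /= eqxx.
Qed.

Lemma ends_neq s e : uniq s -> 1 < size s -> exists2 z, z \in ends s & z != e.
Proof.
case: s => [|a [|b s]] // /andP[abs _] _.
have [ae|ae] := eqVneq a e; last by exists a; rewrite // !inE eqxx.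
exists (last b s); first by rewrite inE /= inE mem_last eqxx !orbT.
by apply: contraNneq abs => lse; rewrite ae -lse mem_last.
Qed.

Lemma rem_meets_ends_eq_mem s v e :
    uniq s -> uniq v -> s =i v -> e \in s -> rem e s != [::] ->
  exists2 z, z \in rem e s & z \in ends v.
Proof.
move=> us uv eq_sv es s'0.
have v_gt1 : 1 < size v.
  rewrite -(perm_size (uniq_perm us uv eq_sv)).
  by move: s'0; rewrite -size_eq0 size_rem //; case: (size s) => [|[]].
have [z z_end ze] := ends_neq e uv v_gt1.
by exists z; rewrite ?rem_mem // eq_sv; case/andP: z_end.
Qed.

End Ends.

Section SimplePaths.

Variables (T : eqType) (f : T -> T).
Implicit Types (s v : seq T) (e x y : T).

Definition ufsorted s := sorted (frel f) s && uniq s.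

Lemma ufsorted_traject s a :
  ufsorted (a :: s) -> a :: s = traject f a (size s).+1.
Proof. by case/andP=> /fpathE-> _; rewrite size_traject. Qed.

Lemma ufsorted_rem_end s e : e \in ends s -> ufsorted s -> ufsorted (rem e s).
Proof.
move=> /andP[es end_e] /andP[ss us]; rewrite /ufsorted rem_uniq // andbT.
case/orP: end_e => /eqP.
  by case: s es ss {us} => //= a s _ /path_sorted ss ->; rewrite eqxx.
case/lastP: s es ss us => // s b _; rewrite last_rcons => + + eb.
rewrite eb rcons_uniq -cats1 => /cat_sorted2[ss _] /andP[es _].
have -> : rem e (s ++ [:: e]) = s; last by [].
by rewrite remE index_cat (negPf es) /= eqxx addn0 take_size_cat // cats1
  drop_oversize ?cats0 // size_rcons.
Qed.

Lemma ufsorted_neighbour s x :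
    ufsorted s -> x \in s -> rem x s != [::] ->
  exists2 y, y \in rem x s & (f x == y) || (f y == x).
Proof.
move=> /andP[ss us] /path.splitPr ps.
case: ps ss us => p1 p2 ss us s'0.
have [_ /= xp2] := cat_sorted2 ss.
case: p2 => [|b p2] in ss us s'0 xp2 *.
  case/lastP: p1 => [|p1 a] in ss us s'0 *; first by rewrite /= eqxx in s'0.
  exists a.
    rewrite mem_rem_uniq // !inE mem_cat mem_rcons mem_head andbT.
    by move: us; rewrite cat_rcons cat_uniq /= inE => /and4P[].
  move: ss; rewrite cat_rcons => /cat_sorted2[_ /= /andP[/eqP-> _]].
  by rewrite eqxx orbT.
exists b; last by case/andP: xp2 => /= ->.
rewrite mem_rem_uniq // !inE mem_cat !inE eqxx !orbT andbT eq_sym.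
by move: us; rewrite cat_uniq => /and3P[_ _ /= /andP[/norP[]]].
Qed.

Hypothesis f_inj : injective f.

Lemma ends_neighbour v e y :
    ufsorted v -> y \in v -> e \notin v -> (f e == y) || (f y == e) ->
  y \in ends v.
Proof.
move=> /andP[sv _] yv ev nbr; rewrite inE /= yv.
case/path.splitPr: yv => p1 p2 in sv ev nbr *.
case/orP: nbr => /eqP fe.
  case/lastP: p1 => [|p1 a] in sv ev *; first by rewrite /= eqxx.
  move: sv ev; rewrite cat_rcons => /cat_sorted2[_ /= /andP[/eqP fa _]].
  by rewrite mem_cat inE (f_inj (etrans fe (esym fa))) eqxx orbT.
case: p2 => [|b p2] in sv ev *; first by rewrite last_cat /= eqxx orbT.
have [_ /= /andP[/eqP fb _]] := cat_sorted2 sv.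
by move: ev; rewrite mem_cat !inE -fb fe eqxx !orbT.
Qed.

Lemma rem_meets_ends_notin s v e :
    ufsorted s -> ufsorted v -> e \in s -> e \notin v -> rem e s != [::] ->
    {subset rem e s <= v} ->
  exists2 y, y \in rem e s & y \in ends v.
Proof.
move=> fs fv es ev s'0 sv; have [y ys nbr] := ufsorted_neighbour fs es s'0.
by exists y => //; apply: ends_neighbour ev nbr => //; apply: sv.
Qed.

End SimplePaths.

Section NestedMembers.

Variables T J : eqType.
Implicit Types (s : J -> seq T) (i j : J).

Definition nested s i j :=
  [&& i != j, s i != [::] & all (mem (s j)) (s i)].

Lemma nestedP s i j :
  reflect [/\ i != j, s i != [::] & {subset s i <= s j}] (nested s i j).
Proof. by apply: (iffP and3P) => -[? ? /allP]; split. Qed.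

Definition nested_meet_ends s :=
  forall i j, nested s i j -> exists2 e, e \in s i & e \in ends (s j).

Definition trim s j e : J -> seq T := [eta s with j |-> rem e (s j)].

Variable f : T -> T.
Hypothesis f_inj : injective f.

Lemma nested_meet_ends_rem s x :
    (forall j, ufsorted f (s j)) ->
    (forall i j, i != j -> ~ {subset s i <= s j}) ->
  nested_meet_ends (fun j => rem x (s j)).
Proof.
move=> fs anti i j /nestedP[neq_ij s'i0 s'ij].
have sij y : y \in s i -> y != x -> y \in s j.
  by move=> yi yx; apply: mem_rem (s'ij _ (rem_mem yx yi)).
have xj : x \notin s j.
  apply/negP=> xj; apply: (anti _ _ neq_ij) => y yi.
  by have [->|] := eqVneq y x; last exact: sij.
have xi : x \in s i.
  apply: contraPT (anti _ _ neq_ij) => xi /(_ _)[] y yi.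
  by apply: sij => //; apply: contraNneq xi => <-.
rewrite (rem_id xj) in s'ij *.
exact: (rem_meets_ends_notin f_inj (fs i) (fs j) xi xj s'i0 s'ij).
Qed.

Lemma nested_meet_ends_trim s j e :
    (forall k, ufsorted f (s k)) -> nested_meet_ends s ->
    (forall k, nested s j k -> size (s k) <= size (s j)) -> e \in s j ->
  nested_meet_ends (trim s j e).
Proof.
move=> fs meet max_j ej k l /nestedP[neq_kl]; rewrite /trim /=.
have us m : uniq (s m) by case/andP: (fs m).
have j0 : s j != [::] by case: (s j) ej.
have [kj|_] := eqVneq k j; have [lj|neq_lj] := eqVneq l j => s'k0 s'kl.
- by rewrite kj lj eqxx in neq_kl.
- have [el|el] := boolP (e \in s l); last first.
    exact: (rem_meets_ends_notin f_inj (fs j) (fs l) ej el s'k0 s'kl).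
  have sjl : {subset s j <= s l}.
    by move=> z zj; have [->//|ze] := eqVneq z e; apply/s'kl/rem_mem.
  have nested_jl : nested s j l by apply/nestedP; split; rewrite // eq_sym.
  have [_ eq_mem] := uniq_min_size (us j) sjl (max_j l nested_jl).
  exact: rem_meets_ends_eq_mem (us j) (us l) eq_mem ej s'k0.
- have sub_kj : {subset s k <= s j} by move=> z /s'kl/mem_rem.
  have [z zk z_end] : exists2 z, z \in s k & z \in ends (s j).
    by apply: meet; apply/nestedP; rewrite -lj in sub_kj *; split.
  exists z => //; apply: ends_rem z_end _.
  by apply: contraTneq (s'kl _ zk) => ->; rewrite mem_rem_uniqF.
- by apply: meet; apply/nestedP; split.
Qed.

End NestedMembers.

Lemma sum_size_trim (T : eqType) (J : finType) (s : J -> seq T) j e :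
  e \in s j -> \sum_k size (trim s j e k) < \sum_k size (s k).
Proof.
move=> ej; rewrite [ltnRHS](bigD1 j) //= (bigD1 j) //= /trim /= eqxx -addSn.
apply: leq_add.
  by rewrite size_rem // prednK //; case: (s j) ej.
by apply: leq_sum => k /negPf->.
Qed.

Lemma set_seq_rem (T : finType) (s : seq T) e :
  uniq s -> [set:: rem e s] = [set:: s] :\ e.
Proof. by move=> us; apply/setP=> z; rewrite !inE mem_rem_uniq. Qed.

Lemma presentation_trim_seq (T J : finType) (M : matroid T)
    (s : J -> seq T) i j e :
    uniq (s j) -> nested s i j -> e \in s i ->
    presentation M (fun k => [set:: s k]) ->
  presentation M (fun k => [set:: trim s j e k]).
Proof.
move=> us /nestedP[neq_ij _ sij] ei presM.
have sub_ij : [set:: s i] \subset [set:: s j].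
  by apply/subsetP=> y; rewrite !inE; apply: sij.
have e_i : e \in [set:: s i] by rewrite inE.
apply: eq_presentation (presentation_trim neq_ij sub_ij e_i presM) => k.
by rewrite /trim /=; case: eqP => // _; rewrite set_seq_rem.
Qed.

Section SigmaIntervals.

Variables (T : finType) (E : {set T}) (sigma : {perm T}).

Lemma sigma_interval_ufsorted (I : {set T}) :
    cyclic_perm_on E sigma -> sigma_interval E sigma I ->
  exists2 s, ufsorted sigma s & I = [set:: s].
Proof.
move=> [_ cyc] [a [n [aE ltnE ->]]]; exists (traject sigma a n.+1).
  rewrite /ufsorted /= fpath_traject.
  have le_orbit : n.+1 <= #|porbit sigma a|.
    by apply: leq_trans ltnE (subset_leq_card _); apply/subsetP=> y; apply: cyc.
  rewrite -[_ && _]/(uniq (traject sigma a n.+1)) -(take_traject _ _ le_orbit).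
  exact/take_uniq/uniq_traject_porbit.
by apply/setP=> y; rewrite !inE.
Qed.

Lemma ufsorted_sigma_interval s :
    ufsorted sigma s -> s != [::] -> [set:: s] \subset E ->
  sigma_interval E sigma [set:: s].
Proof.
case: s => // a s ss _ sE; exists a, (size s); split.
- by apply: (subsetP sE); rewrite inE mem_head.
- have [_ /card_uniqP card_s] := andP ss.
  by rewrite -[_.+1]card_s -(cardsE (mem (a :: s))) subset_leq_card.
- by apply/setP=> y; rewrite -ufsorted_traject // !inE.
Qed.

End SigmaIntervals.

Section MultiPathCriterion.

Variables (T J : finType) (M : matroid T) (sigma : {perm T}).
Hypothesis sigma_cyclic : cyclic_perm_on (ground M) sigma.
Implicit Type s : J -> seq T.

Lemma multi_path_matroid_unnested s :
    (forall j, ufsorted sigma (s j)) -> (forall i j, ~~ nested s i j) ->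
    presentation M (fun j => [set:: s j]) ->
  multi_path_matroid M.
Proof.
move=> ss unnested presM; have s0 j : [set:: s j] != set0 -> s j != [::].
  by apply: contraNneq => ->; rewrite set_nil.
exists sigma, {j | [set:: s j] != set0}, (fun j => [set:: s (val j)]).
split=> // [j|i j neq_ij|].
- by apply: ufsorted_sigma_interval; rewrite ?s0 ?(valP j) //; apply: presM.1.
- apply: contra (unnested (val i) (val j)) => /subsetP sij; apply/nestedP.
  split; rewrite ?s0 ?(valP i) // => y yi.
  by have := sij y; rewrite !inE; apply.
- exact: presentation_nonempty presM.
Qed.

Lemma multi_path_matroid_nested_meet_ends s :
    (forall j, ufsorted sigma (s j)) -> nested_meet_ends s ->
    presentation M (fun j => [set:: s j]) ->
  multi_path_matroid M.
Proof.
have [m] := ubnP (\sum_j size (s j)); elim: m s => // m IHm s.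
move=> lt_sm ss meet presM.
pose outer j := [exists i, nested s i j].
have outerI i j : nested s i j -> outer j by move=> ?; apply/existsP; exists i.
have [/existsP[j0 outer_j0]|no_outer] := boolP [exists j, outer j]; last first.
  apply: multi_path_matroid_unnested ss _ presM => i j.
  by apply: contra no_outer => /outerI outer_j; apply/existsP; exists j.
case: (arg_maxnP (fun j => size (s j)) outer_j0).
move=> j /existsP[i nested_ij] max_j.
have [e ei e_end] := meet i j nested_ij.
have ej : e \in s j by case/andP: e_end.
apply: (IHm (trim s j e)).
- exact: leq_trans (sum_size_trim ej) lt_sm.
- by move=> k; rewrite /trim /=; case: eqP => // _; apply: ufsorted_rem_end.
- apply: nested_meet_ends_trim ej => //; first exact: perm_inj.
  by move=> k nested_jk; apply/max_j/outerI/nested_jk.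
- by apply: presentation_trim_seq nested_ij ei presM; case/andP: (ss j).
Qed.

End MultiPathCriterion.

Section Bypass.

Variables (T : finType) (sigma : {perm T}) (x : T).

Definition bypass : {perm T} := (sigma * tperm x (sigma x))%g.

Lemma bypassE y : y != x ->
  bypass y = if sigma y == x then sigma x else sigma y.
Proof.
move=> yx; rewrite permM; case: tpermP => [->|/perm_inj/eqP|/eqP/negPf->] //.
  by rewrite eqxx.
by rewrite (negPf yx).
Qed.

Lemma bypass_fix : bypass x = x.
Proof. by rewrite permM tpermR. Qed.

Lemma filter_traject_bypass a n : exists m,
  [seq y <- traject sigma a n | y != x] =
  traject bypass (if a == x then sigma x else a) m.
Proof.
elim: n a => [|n IHn] a; first by exists 0.
have [m eqm] := IHn (sigma a); rewrite /=; case: eqVneq => [ax|ax] /=.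
  rewrite eqm ax; have [sx|_] := eqVneq (sigma x) x; last by exists m.
  by exists m; rewrite sx.
by exists m.+1; rewrite eqm /= bypassE.
Qed.

Lemma cyclic_perm_on_bypass (E : {set T}) :
  cyclic_perm_on E sigma -> cyclic_perm_on (E :\ x) bypass.
Proof.
move=> [onE cyc]; split=> [|y z].
  apply/subsetP=> y; rewrite !inE; have [->|yx] := eqVneq y x.
    by rewrite bypass_fix eqxx.
  apply: contraR => yE; rewrite bypassE // (out_perm onE yE).
  by rewrite (negPf yx).
rewrite !inE => /andP[yx yE] /andP[zx zE].
have := cyc _ _ yE zE; rewrite porbit_traject => zy.
have [m] := filter_traject_bypass y #|porbit sigma y|.
move/(congr1 (fun r => z \in r)); rewrite mem_filter zx zy (negPf yx).
move/esym/trajectP=> [k _ ->]; apply/porbitP; exists k.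
by rewrite permX.
Qed.

Lemma ufsorted_rem_bypass s : ufsorted sigma s -> ufsorted bypass (rem x s).
Proof.
case: s => // a s /[dup] /andP[_ us] /ufsorted_traject eqs.
rewrite /ufsorted rem_uniq // andbT rem_filter // eqs.
have [[|m] ->] := filter_traject_bypass a (size s).+1 => //.
exact: fpath_traject.
Qed.

End Bypass.

Theorem theorem3p3 (T : finType) (M : matroid T) (x : T)
    (hM : multi_path_matroid M) (hx : x \in ground M) :
  multi_path_matroid (deletion M x).
Proof.
have [sigma [J [A [cyc intA antiA presA]]]] := hM.
have [s ss sE] :=
  fin_all_exists2 (fun j => sigma_interval_ufsorted cyc (intA j)).
have antis i j : i != j -> ~ {subset s i <= s j}.
  move=> /antiA/subsetP not_sub sij; apply: not_sub => y.
  by rewrite !sE !inE; apply: sij.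
apply: (multi_path_matroid_nested_meet_ends (M := deletion M x)
  (cyclic_perm_on_bypass x cyc) (s := fun j => rem x (s j))).
- by move=> j; apply: ufsorted_rem_bypass.
- by apply: nested_meet_ends_rem antis; first exact: (@perm_inj _ sigma).
- apply: eq_presentation (presentation_deletion x presA) => j.
  by rewrite sE set_seq_rem //; case/andP: (ss j).
Qed.
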